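(* There exists a universal constant $K>0$ such that the following holds. Let $d\ge1$, $\varepsilon>0$ and $T\ge K\cdot\frac{d}{\varepsilon^2}$. There is an algorithm which, given one copy each of unknown $d$-dimensional quantum states $\rho_1,\dots,\rho_T$ (i.e., given the state $\rho_1\otimes\cdots\otimes\rho_T$), distinguishes with probability at least $0.99$ the case $\rho_{\mathrm{avg}}=\frac{I}{d}$ from the case $D_{\mathrm{tr}}(\rho_{\mathrm{avg}},\frac{I}{d})>\varepsilon$, where $\rho_{\mathrm{avg}}=\frac1T\sum_{t=1}^T\rho_t$.
   Context: Quantum states are $d\times d$ density matrices. $D_{\mathrm{tr}}(\rho,\sigma)=\frac12\|\rho-\sigma\|_1$ (trace norm) is the trace distance. The algorithm may apply any quantum measurement to $\rho_1\otimes\cdots\otimes\rho_T$ (chosen depending on $d,\varepsilon,T$ only) and outputs accept/reject; ''distinguishes with probability at least $0.99$'' means it accepts with probability at least $0.99$ in the first case and rejects with probability at least $0.99$ in the second case. *)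

(* Defs.v *)
From HB Require Import structures.
From mathcomp Require Import all_boot all_order all_algebra.
From mathcomp Require Export complex.
From mathcomp Require Export reals.
Set Implicit Arguments. Unset Strict Implicit. Unset Printing Implicit Defensive.
Import Order.TTheory GRing.Theory Num.Theory Num.Def.
Local Open Scope ring_scope.

Section Quantum.
Variable C : numClosedFieldType.

Definition adjmx m n (A : 'M[C]_(m, n)) : 'M[C]_(n, m) := (map_mx conjC A)^T.

Definition hermitian n (A : 'M[C]_n) : Prop := adjmx A = A.

Definition psd n (A : 'M[C]_n) : Prop :=
  hermitian A /\ forall v : 'rV[C]_n, 0 <= (v *m A *m adjmx v) 0 0.

Definition density n (rho : 'M[C]_n) : Prop := psd rho /\ \tr rho = 1.

(* trace norm ||A||_1 = tr sqrt(A^dagger A) = sum of square roots of the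
   eigenvalues of the Hermitian PSD matrix A^dagger A *)
Definition trace_norm n (A : 'M[C]_n) : C :=
  \sum_(i < n) sqrtC ((spectral_diag (adjmx A *m A)) 0 i).

Definition trace_dist n (rho sigma : 'M[C]_n) : C :=
  2^-1 * trace_norm (rho - sigma).

Definition maxmixed d : 'M[C]_d := (d%:R)^-1 *: 1%:M.

Definition avg_state d T (rho : 'I_T -> 'M[C]_d) : 'M[C]_d :=
  (T%:R)^-1 *: \sum_(t < T) rho t.

(* The T-fold tensor product space (C^d)^{\otimes T} has the computational
   basis indexed by functions 'I_T -> 'I_d (there are d^T of them). *)
Definition tdim d T : nat := #|{ffun 'I_T -> 'I_d}|.

(* rho_1 \otimes ... \otimes rho_T, entrywise
   <i|rho_1 (x) ... (x) rho_T|j> = prod_t <i_t|rho_t|j_t> *)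
Definition tensor_states d T (rho : 'I_T -> 'M[C]_d) : 'M[C]_(tdim d T) :=
  \matrix_(i, j) \prod_(t < T)
     rho t (@enum_val _ (mem {: {ffun 'I_T -> 'I_d}}) i t)
           (@enum_val _ (mem {: {ffun 'I_T -> 'I_d}}) j t).

(* A two-outcome measurement {M, I - M} (accept / reject): 0 <= M <= I *)
Definition accept_op N (M : 'M[C]_N) : Prop := psd M /\ psd (1%:M - M).

Definition accept_prob N (M rho : 'M[C]_N) : C := \tr (M *m rho).

End Quantum.

(* Main.v *)
Require Import Defs.
From HB Require Import structures.
From mathcomp Require Import all_boot all_order all_algebra.
From mathcomp Require Import complex reals ring lra.
Import Order.TTheory GRing.Theory Num.Theory.
Local Open Scope ring_scope.

Set Implicit Arguments.
Unset Strict Implicit.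
Unset Printing Implicit Defensive.

(** Measure X = sum_(s <> t) SWAP_st and accept when the outcome is at most
    T^2/d + 100 T.  Writing S = sum_t rho_t = T rho_avg and mu = tr (S - (T/d) I)^2,
    the mean of X is tr S^2 - sum_t tr rho_t^2 = mu + T^2/d - q with 0 <= q <= T.
    Centring the two sites of each swap gives X - E X = U + 2 L, where U sums the
    doubly centred swaps and L = sum_t (S - rho_t - tr ((S - rho_t) rho_t))_t is a sum of
    centred one-site terms.  Distinct unordered pairs contribute orthogonally to U, so
    E U^2 <= 2 T^2; distinct sites contribute orthogonally to L, and since S may be
    replaced by S - (T/d) I, E L^2 <= 2 T mu + 2 T.  Hence
    Var X <= 20 T^2 + 16 T mu.  When rho_avg = I/d, mu = 0; when the trace distance
    exceeds eps, Cauchy-Schwarz gives mu >= 4 eps^2 T^2 / d >= 4 K T.  In both cases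
    Chebyshev's inequality, applied to the spectral projector of X, concludes. *)

(** * Hermitian matrices and their functional calculus *)

Section LinearAlgebra.
Variable C : numClosedFieldType.
Local Notation herm := (@Defs.hermitian C _).

Lemma adjmxE m n (A : 'M[C]_(m, n)) i j : adjmx A i j = (A j i)^*.
Proof. by rewrite !mxE. Qed.

Lemma adjmxK m n (A : 'M[C]_(m, n)) : adjmx (adjmx A) = A.
Proof. by apply/matrixP=> i j; rewrite !mxE conjCK. Qed.

Lemma adjmxM m n p (A : 'M[C]_(m, n)) (B : 'M[C]_(n, p)) :
  adjmx (A *m B) = adjmx B *m adjmx A.
Proof. by rewrite /adjmx map_mxM trmx_mul. Qed.

Lemma adjmxD m n (A B : 'M[C]_(m, n)) : adjmx (A + B) = adjmx A + adjmx B.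
Proof. by rewrite /adjmx map_mxD linearD. Qed.

Lemma adjmxB m n (A B : 'M[C]_(m, n)) : adjmx (A - B) = adjmx A - adjmx B.
Proof. by rewrite /adjmx map_mxB linearB. Qed.

Lemma adjmxZ m n (a : C) (A : 'M[C]_(m, n)) : adjmx (a *: A) = a^* *: adjmx A.
Proof. by apply/matrixP=> i j; rewrite !mxE rmorphM. Qed.

Lemma adjmx_sum m n I (r : seq I) (P : pred I) (F : I -> 'M[C]_(m, n)) :
  adjmx (\sum_(i <- r | P i) F i) = \sum_(i <- r | P i) adjmx (F i).
Proof.
apply: (big_morph (@adjmx C m n) (@adjmxD m n)).
by apply/matrixP=> i j; rewrite !mxE rmorph0.
Qed.

Lemma adjmx_scalar n (a : C) : adjmx (a%:M : 'M[C]_n) = (a^*)%:M.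
Proof. by rewrite /adjmx map_scalar_mx tr_scalar_mx. Qed.

Lemma adjmx_delta n (i j : 'I_n) :
  adjmx (delta_mx i j : 'M[C]_n) = delta_mx j i.
Proof. by rewrite /adjmx map_delta_mx trmx_delta. Qed.

Lemma hermD n (A B : 'M[C]_n) : herm A -> herm B -> herm (A + B).
Proof. by rewrite /Defs.hermitian adjmxD => -> ->. Qed.

Lemma hermB n (A B : 'M[C]_n) : herm A -> herm B -> herm (A - B).
Proof. by rewrite /Defs.hermitian adjmxB => -> ->. Qed.

Lemma hermZ n (a : C) (A : 'M[C]_n) : a \is Num.real -> herm A -> herm (a *: A).
Proof. by rewrite /Defs.hermitian adjmxZ => /conj_Creal-> ->. Qed.

Lemma herm_scalar n (a : C) : a \is Num.real -> herm (a%:M : 'M[C]_n).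
Proof. by rewrite /Defs.hermitian adjmx_scalar => /conj_Creal->. Qed.

Lemma herm_sum n I (r : seq I) (P : pred I) (F : I -> 'M[C]_n) :
  (forall i, P i -> herm (F i)) -> herm (\sum_(i <- r | P i) F i).
Proof. by move=> hF; rewrite /Defs.hermitian adjmx_sum; apply: eq_bigr. Qed.

Lemma mxtrace_adj n (A : 'M[C]_n) : \tr (adjmx A) = (\tr A)^*.
Proof. by rewrite /adjmx mxtrace_tr /mxtrace rmorph_sum; apply: eq_bigr => i _; rewrite mxE. Qed.

Lemma tr_herm_mul_real n (A B : 'M[C]_n) :
  herm A -> herm B -> \tr (A *m B) \is Num.real.
Proof.
move=> hA hB; apply/CrealP.
by rewrite -mxtrace_adj adjmxM hA hB mxtrace_mulC.
Qed.

Lemma mxtrace_mul3C n (A B D : 'M[C]_n) : \tr (A *m B *m D) = \tr (B *m D *m A).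
Proof. by rewrite -mulmxA mxtrace_mulC. Qed.

Lemma mulmx_adj_ge0 n (v : 'rV[C]_n) : 0 <= (v *m adjmx v) 0 0.
Proof.
by rewrite mxE sumr_ge0 // => i _; rewrite adjmxE mul_conjC_ge0.
Qed.

Lemma psd_gram m n (B : 'M[C]_(m, n)) : psd (adjmx B *m B).
Proof.
split; first by rewrite /Defs.hermitian adjmxM adjmxK.
move=> v; have -> : v *m (adjmx B *m B) *m adjmx v
    = (v *m adjmx B) *m adjmx (v *m adjmx B).
  by rewrite adjmxM adjmxK !mulmxA.
exact: mulmx_adj_ge0.
Qed.

Lemma psd_conj_diag_ge0 n (A P : 'M[C]_n) i : psd A -> 0 <= (P *m A *m adjmx P) i i.
Proof.
move=> [_ /(_ (row i P))]; congr (0 <= _).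
by rewrite -row_mul !mxE; apply: eq_bigr => j _; rewrite !mxE.
Qed.

(** Cyclicity turns the trace into that of [Y *m W *m adjmx Y], whose diagonal entries are values of
    the quadratic form of [W]. *)
Lemma tr_gram_psd_ge0 n (Y W : 'M[C]_n) : psd W -> 0 <= \tr (adjmx Y *m Y *m W).
Proof.
move=> hW; rewrite mxtrace_mul3C.
by apply: sumr_ge0 => i _; apply: psd_conj_diag_ge0.
Qed.

Lemma tr_herm_sq_ge0 n (Y W : 'M[C]_n) : herm Y -> psd W -> 0 <= \tr (Y *m Y *m W).
Proof. by move=> hY; rewrite -{1}hY; apply: tr_gram_psd_ge0. Qed.

(** Parallelogram law: the gap between the two sides is the second moment of [A - B]. *)
Lemma tr_sqD_le n (A B W : 'M[C]_n) : herm A -> herm B -> psd W ->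
  \tr ((A + B) *m (A + B) *m W)
    <= 2 * \tr (A *m A *m W) + 2 * \tr (B *m B *m W).
Proof.
move=> hA hB hW; rewrite -subr_ge0.
have -> : 2 * \tr (A *m A *m W) + 2 * \tr (B *m B *m W)
    - \tr ((A + B) *m (A + B) *m W) = \tr ((A - B) *m (A - B) *m W).
  rewrite !(mulmxDl, mulmxDr, mulmxN, mulNmx) !mxtraceD !opprK !(raddfN mxtrace) /=.
  ring.
by apply: tr_herm_sq_ge0 => //; apply: hermB.
Qed.


(** * Spectral functional calculus *)

Lemma spectralmx_mul_adj n (A : 'M[C]_n) : spectralmx A *m adjmx (spectralmx A) = 1%:M.
Proof. by rewrite /adjmx map_trmx; apply/unitarymxP/spectral_unitarymx. Qed.

Lemma adj_mul_spectralmx n (A : 'M[C]_n) : adjmx (spectralmx A) *m spectralmx A = 1%:M.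
Proof. exact/mulmx1C/spectralmx_mul_adj. Qed.

(** For Hermitian [A] the rows of [spectralmx A] are eigenvectors, hence the adjoint on the left.
    That matrix is unitary for every [A], so products, differences and constants behave well without
    Hermiticity, which serves to recover [A] from [id]. *)
Definition spectral_fun n (A : 'M[C]_n) (f : C -> C) : 'M[C]_n :=
  adjmx (spectralmx A) *m diag_mx (map_mx f (spectral_diag A)) *m spectralmx A.

Lemma herm_hermsymmx n (A : 'M[C]_n) : herm A -> A \is hermsymmx.
Proof.
by move=> hA; apply/is_hermitianmxP; rewrite expr0 scale1r -[LHS]hA /adjmx map_trmx.
Qed.

Lemma spectral_fun_id n (A : 'M[C]_n) : herm A -> spectral_fun A id = A.
Proof.
move=> /herm_hermsymmx/hermitian_normalmx/orthomx_spectralP {2}->.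
rewrite invmx_unitary ?spectral_unitarymx // /spectral_fun /adjmx map_trmx.
by rewrite (map_mx_id (fun=> erefl)).
Qed.

Lemma eq_spectral_fun n (A : 'M[C]_n) (f g : C -> C) :
  (forall i, f (spectral_diag A 0 i) = g (spectral_diag A 0 i)) ->
  spectral_fun A f = spectral_fun A g.
Proof.
move=> fg; rewrite /spectral_fun; congr (_ *m diag_mx _ *m _).
by apply/rowP=> i; rewrite !mxE.
Qed.

Lemma spectral_fun_cst n (A : 'M[C]_n) a : spectral_fun A (fun=> a) = a%:M.
Proof.
rewrite /spectral_fun (_ : map_mx _ _ = const_mx a); last by apply/rowP=> i; rewrite !mxE.
by rewrite diag_const_mx mul_mx_scalar -scalemxAl adj_mul_spectralmx scalemx1.
Qed.

Lemma spectral_funM n (A : 'M[C]_n) f g :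
  spectral_fun A f *m spectral_fun A g = spectral_fun A (fun x => f x * g x).
Proof.
rewrite /spectral_fun !mulmxA; congr (_ *m _).
rewrite -(mulmxA _ (spectralmx A)) spectralmx_mul_adj mulmx1 -mulmxA mulmx_diag.
by congr (_ *m diag_mx _); apply/rowP=> i; rewrite !mxE.
Qed.

Lemma spectral_funB n (A : 'M[C]_n) f g :
  spectral_fun A f - spectral_fun A g = spectral_fun A (fun x => f x - g x).
Proof.
rewrite /spectral_fun -mulmxBl -mulmxBr -linearB /=; congr (_ *m diag_mx _ *m _).
by apply/rowP=> i; rewrite !mxE.
Qed.

Lemma spectral_funZ n (A : 'M[C]_n) a f :
  a *: spectral_fun A f = spectral_fun A (fun x => a * f x).
Proof. by rewrite -mul_scalar_mx -(spectral_fun_cst A) spectral_funM. Qed.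

Lemma herm_spectral_fun n (A : 'M[C]_n) f :
  (forall i, f (spectral_diag A 0 i) \is Num.real) -> herm (spectral_fun A f).
Proof.
move=> rf; rewrite /Defs.hermitian /spectral_fun !adjmxM adjmxK -mulmxA.
congr (_ *m (_ *m _)); rewrite /adjmx map_diag_mx tr_diag_mx; congr diag_mx.
by apply/rowP=> i; rewrite !mxE; apply: conj_Creal.
Qed.

Lemma spectral_fun_gram n (A : 'M[C]_n) f (B := spectral_fun A (fun x => sqrtC (f x))) :
  (forall i, 0 <= f (spectral_diag A 0 i)) -> spectral_fun A f = adjmx B *m B.
Proof.
move=> f0; have -> : adjmx B = B.
  by apply: herm_spectral_fun => i; rewrite ger0_real // sqrtC_ge0.
by rewrite spectral_funM; apply: eq_spectral_fun => i; rewrite -expr2 sqrtCK.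
Qed.

Lemma psd_spectral_fun n (A : 'M[C]_n) f :
  (forall i, 0 <= f (spectral_diag A 0 i)) -> psd (spectral_fun A f).
Proof. by move=> /spectral_fun_gram->; apply: psd_gram. Qed.

Lemma spectral_diagE n (A : 'M[C]_n) i : herm A ->
  spectral_diag A 0 i = (spectralmx A *m A *m adjmx (spectralmx A)) i i.
Proof.
move=> hA; rewrite -{3}(spectral_fun_id hA) /spectral_fun !mulmxA spectralmx_mul_adj.
by rewrite mul1mx -mulmxA spectralmx_mul_adj mulmx1 !mxE eqxx.
Qed.

Lemma spectral_diag_real n (A : 'M[C]_n) i : herm A -> spectral_diag A 0 i \is Num.real.
Proof.
move=> hA; rewrite spectral_diagE //; apply/CrealP.
by rewrite -adjmxE !adjmxM adjmxK hA mulmxA.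
Qed.

Lemma spectral_diag_ge0 n (A : 'M[C]_n) i : psd A -> 0 <= spectral_diag A 0 i.
Proof. by move=> hA; rewrite (spectral_diagE _ (proj1 hA)); apply: psd_conj_diag_ge0. Qed.

Lemma tr_spectral_fun n (A : 'M[C]_n) f :
  \tr (spectral_fun A f) = \sum_i f (spectral_diag A 0 i).
Proof.
rewrite /spectral_fun mxtrace_mulC mulmxA spectralmx_mul_adj mul1mx mxtrace_diag.
by apply: eq_bigr => i _; rewrite !mxE.
Qed.

Lemma psd_sqrt n (A : 'M[C]_n) : psd A -> exists B : 'M[C]_n, A = adjmx B *m B.
Proof.
move=> hA; rewrite -{1}(spectral_fun_id (proj1 hA)) spectral_fun_gram; first by eexists.
by move=> i; apply: spectral_diag_ge0.
Qed.

Lemma tr_psdM_ge0 n (A B : 'M[C]_n) : psd A -> psd B -> 0 <= \tr (A *m B).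
Proof. by move=> /psd_sqrt[Y ->]; apply: tr_gram_psd_ge0. Qed.

(** The eigenvalues are nonnegative and sum to 1, so each is at most 1. *)
Lemma density_le1 n (rho : 'M[C]_n) : density rho -> psd (1%:M - rho).
Proof.
move=> [hrho tr1]; rewrite -{1}(spectral_fun_id (proj1 hrho)) -(spectral_fun_cst rho).
rewrite spectral_funB; apply: psd_spectral_fun => i; rewrite subr_ge0.
rewrite -tr1 -{2}(spectral_fun_id (proj1 hrho)) tr_spectral_fun (bigD1 i) //=.
by rewrite lerDl sumr_ge0 // => j _; apply: spectral_diag_ge0.
Qed.

Lemma tr_psd_density_le n (A rho : 'M[C]_n) : psd A -> density rho ->
  \tr (A *m rho) <= \tr A.
Proof.
move=> hA hrho; rewrite -subr_ge0 -{1}(mulmx1 A) -linearB /= -mulmxBr.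
by apply: tr_psdM_ge0 => //; apply: density_le1.
Qed.

Lemma herm_sq_psd n (A : 'M[C]_n) : herm A -> psd (A *m A).
Proof. by move=> hA; rewrite -{1}hA; apply: psd_gram. Qed.

Lemma tr_density_sq_le1 n (rho : 'M[C]_n) : density rho -> \tr (rho *m rho) <= 1.
Proof. by move=> hrho; rewrite -(proj2 hrho); apply: tr_psd_density_le => //; case: hrho. Qed.

(** Cauchy-Schwarz against the all-ones vector: twice the gap is the sum of [(F i - F j) ^+ 2] over
    all [i] and [j]. *)
Lemma sqr_sum_le n (F : 'I_n -> C) : (forall i, F i \is Num.real) ->
  (\sum_i F i) ^+ 2 <= n%:R * \sum_i F i ^+ 2.
Proof.
move=> rF; rewrite -(ler_pM2l (ltr0n C 2)).
have -> : 2 * (n%:R * \sum_i F i ^+ 2) =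
    \sum_i \sum_j (F i ^+ 2 + F j ^+ 2).
  under [RHS]eq_bigr => i _ do rewrite big_split /= sumr_const card_ord.
  rewrite big_split /= sumr_const card_ord sumrMnl -mulrnDl -mulr_natl; ring.
have -> : 2 * (\sum_i F i) ^+ 2 = \sum_i \sum_j 2 * (F i * F j).
  rewrite expr2 mulr_suml mulr_sumr; apply: eq_bigr => i _.
  by rewrite mulr_sumr mulr_sumr.
apply: ler_sum => i _; apply: ler_sum => j _; rewrite -subr_ge0.
have -> : F i ^+ 2 + F j ^+ 2 - 2 * (F i * F j) = (F i - F j) ^+ 2 by ring.
by rewrite real_exprn_even_ge0 // rpredB.
Qed.

(** Cauchy-Schwarz on the singular values, whose squares are the eigenvalues of [adjmx A *m A] and
    sum to its trace. *)
Lemma trace_norm_sq_le n (A : 'M[C]_n) : 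
  0 <= trace_norm A /\ trace_norm A ^+ 2 <= n%:R * \tr (adjmx A *m A).
Proof.
have ge0 i : 0 <= spectral_diag (adjmx A *m A) 0 i by apply/spectral_diag_ge0/psd_gram.
split; first by rewrite /trace_norm sumr_ge0 // => i _; rewrite sqrtC_ge0.
apply: le_trans (sqr_sum_le _) _; first by move=> i; rewrite ger0_real // sqrtC_ge0.
rewrite -[X in \tr X]spectral_fun_id ?tr_spectral_fun; last by case: (psd_gram A).
by under eq_bigr => i _ do rewrite sqrtCK.
Qed.

(** * Spectral threshold measurement and Chebyshev's inequality *)

Definition spectral_le n (X : 'M[C]_n) (theta : C) : 'M[C]_n :=
  spectral_fun X (fun x => (x <= theta)%R%:R).

Lemma spectral_le_accept n (X : 'M[C]_n) theta : accept_op (spectral_le X theta).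
Proof.
split; first by apply: psd_spectral_fun => i; rewrite ler0n.
rewrite -(spectral_fun_cst X) spectral_funB; apply: psd_spectral_fun => i.
by case: (spectral_diag X 0 i <= theta); rewrite ?subr0 ?subrr.
Qed.

Lemma sub_scalar_spectral n (X : 'M[C]_n) a : herm X ->
  X - a%:M = spectral_fun X (fun x => x - a).
Proof. by move=> hX; rewrite -spectral_funB spectral_fun_id // spectral_fun_cst. Qed.

(** On the spectrum, [(theta - a) ^+ 2] times the indicator of [x > theta] is at most
    [(x - a) ^+ 2]. Functional calculus lifts this to an operator inequality, which is then traced
    against [W]. *)
Lemma chebyshev_upper n (X W : 'M[C]_n) a theta : herm X -> psd W ->
  a \is Num.real -> a <= theta ->
  (theta - a) ^+ 2 * \tr ((1%:M - spectral_le X theta) *m W)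
    <= \tr ((X - a%:M) *m (X - a%:M) *m W).
Proof.
move=> hX hW ra ath; rewrite -mxtraceZ scalemxAl -subr_ge0 -linearB /= -mulmxBl.
apply: tr_psdM_ge0 => //; rewrite /spectral_le -(spectral_fun_cst X 1) spectral_funB spectral_funZ.
rewrite sub_scalar_spectral // spectral_funM spectral_funB.
apply: psd_spectral_fun => i; have := spectral_diag_real i hX.
move: (spectral_diag _ _ _) => x rx; rewrite subr_ge0.
(* The order of [C] is partial: with [a] real, [a <= theta] makes [theta] real and hence comparable
   with every eigenvalue. *)
have rth : theta \is Num.real by rewrite -(subrK a theta) rpredD // ger0_real // subr_ge0.
case: (real_leP rx rth) => hx.
  by rewrite subrr mulr0 -expr2 real_exprn_even_ge0 // rpredB.
by rewrite subr0 mulr1 -expr2 lerXn2r ?nnegrE ?subr_ge0 ?lerB ?(ltW hx) ?(le_trans ath (ltW hx)).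
Qed.

Lemma chebyshev_lower n (X W : 'M[C]_n) a theta : herm X -> psd W ->
  a \is Num.real -> theta <= a ->
  (a - theta) ^+ 2 * \tr (spectral_le X theta *m W)
    <= \tr ((X - a%:M) *m (X - a%:M) *m W).
Proof.
move=> hX hW ra ath; rewrite -mxtraceZ scalemxAl -subr_ge0 -linearB /= -mulmxBl.
apply: tr_psdM_ge0 => //; rewrite /spectral_le spectral_funZ.
rewrite sub_scalar_spectral // spectral_funM spectral_funB.
apply: psd_spectral_fun => i; have := spectral_diag_real i hX.
move: (spectral_diag _ _ _) => x rx; rewrite subr_ge0.
have rth : theta \is Num.real by rewrite -(subKr a theta) rpredB // ger0_real // subr_ge0.
case: (real_leP rx rth) => hx; last first.
  by rewrite mulr0 -expr2 real_exprn_even_ge0 // rpredB.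
rewrite mulr1 -expr2 -(sqrrN (x - a)) opprB.
by rewrite lerXn2r ?nnegrE ?subr_ge0 ?lerB ?(le_trans hx ath).
Qed.

End LinearAlgebra.

(** * The swap statistic on a product state *)

Section Tensor.
Variables (C : numClosedFieldType) (d T : nat).
Local Notation herm := (@Defs.hermitian C _).
Implicit Types (a b rho : 'I_T -> 'M[C]_d) (A B D F : 'M[C]_d) (s t u v : 'I_T).

Lemma eq_tensor a b : a =1 b -> tensor_states a = tensor_states b.
Proof. by move=> ab; apply/matrixP=> i j; rewrite !mxE; apply: eq_bigr => t _; rewrite ab. Qed.

Lemma sum_tdim (F : {ffun 'I_T -> 'I_d} -> C) :
  \sum_(i < tdim d T) F (enum_val i) = \sum_f F f.
Proof. by rewrite -(big_enum_val F). Qed.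

(** Distributing the product over sites of the entrywise sums gives one sum over all functions from
    sites to levels, that is, over the basis of the tensor space. *)
Lemma tensorM a b :
  tensor_states a *m tensor_states b = tensor_states (fun t => a t *m b t).
Proof.
apply/matrixP=> i j; rewrite !mxE.
under eq_bigr => k _ do rewrite !mxE -big_split /=.
rewrite (sum_tdim (fun f => \prod_t (a t (enum_val i t) (f t) * b t (f t) (enum_val j t)))).
under [RHS]eq_bigr => t _ do rewrite mxE.
by rewrite bigA_distr_bigA.
Qed.

Lemma tr_tensor a : \tr (tensor_states a) = \prod_t \tr (a t).
Proof.
rewrite /mxtrace bigA_distr_bigA -(sum_tdim (fun f => \prod_t (a t (f t) (f t)))).
by apply: eq_bigr => i _; rewrite mxE.
Qed.

Lemma adj_tensor a : adjmx (tensor_states a) = tensor_states (fun t => adjmx (a t)).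
Proof.
apply/matrixP=> i j; rewrite !mxE rmorph_prod; apply: eq_bigr => t _.
by rewrite !mxE.
Qed.

Lemma tensor1 : tensor_states (fun=> 1%:M : 'M[C]_d) = 1%:M :> 'M_(tdim d T).
Proof.
apply/matrixP=> i j; rewrite !mxE; have [->|ij] := eqVneq i j.
  by rewrite big1 // => t _; rewrite mxE eqxx.
have [t tij] : exists t : 'I_T, enum_val i t != enum_val j t.
  apply/existsP; apply: contraNT ij => /existsPn h; apply/eqP/enum_val_inj/ffunP=> t.
  by apply/eqP; rewrite -[_ == _]negbK.
by rewrite (bigD1 t) //= mxE (negbTE tij) mul0r.
Qed.

Lemma psd_tensor rho : (forall t, psd (rho t)) -> psd (tensor_states rho).
Proof.
move=> hr; have [B hB] : exists B : 'I_T -> 'M[C]_d, forall t, rho t = adjmx (B t) *m B t.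
  (* The boolean equality lets [xchoose] pick a factor for every site at once. *)
  have h (t : 'I_T) : exists B : 'M[C]_d, rho t == adjmx B *m B.
    by have [B ->] := psd_sqrt (hr t); exists B.
  by exists (fun t => xchoose (h t)) => t; apply/eqP/(xchooseP (h t)).
by rewrite (eq_tensor hB) -tensorM -adj_tensor; apply: psd_gram.
Qed.

(* [A] acting on the tensor factor [t], the identity on the others. *)
Definition loc t A : 'M[C]_(tdim d T) :=
  tensor_states (fun u => if u == t then A else 1%:M).

Lemma loc1 t : loc t 1%:M = 1%:M.
Proof. by rewrite -tensor1; apply: eq_tensor => u; case: ifP. Qed.

(** Isolating the factor at [t] makes the linearity in [A] visible. *)
Lemma locE t A i j : loc t A i j =
  A (enum_val i t) (enum_val j t)
    * \prod_(u < T | u != t) (1%:M : 'M[C]_d) (enum_val i u) (enum_val j u).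
Proof.
rewrite mxE (bigD1 t) //= eqxx; congr (_ * _).
by apply: eq_bigr => u /negbTE ->.
Qed.

Lemma locD t A B : loc t (A + B) = loc t A + loc t B.
Proof. by apply/matrixP=> i j; rewrite [RHS]mxE !locE mxE mulrDl. Qed.

Lemma locZ t x A : loc t (x *: A) = x *: loc t A.
Proof. by apply/matrixP=> i j; rewrite [RHS]mxE !locE mxE mulrA. Qed.

Lemma loc0 t : loc t 0 = 0.
Proof. by rewrite -(scale0r (0 : 'M[C]_d)) locZ scale0r. Qed.

Lemma locB t A B : loc t (A - B) = loc t A - loc t B.
Proof. by rewrite -scaleN1r locD locZ scaleN1r. Qed.

Lemma loc_scalar t x : loc t x%:M = x%:M.
Proof. by rewrite -[x%:M]scalemx1 locZ loc1 scalemx1. Qed.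

Lemma loc_sum t I (r : seq I) (P : pred I) (G : I -> 'M[C]_d) :
  loc t (\sum_(i <- r | P i) G i) = \sum_(i <- r | P i) loc t (G i).
Proof. exact: (big_morph (loc t) (locD t) (loc0 t)). Qed.

Lemma locM t A B : loc t A *m loc t B = loc t (A *m B).
Proof. by rewrite tensorM; apply: eq_tensor => u; case: ifP; rewrite ?mulmx1. Qed.

Lemma loc_mulC s t A B : s != t -> loc s A *m loc t B = loc t B *m loc s A.
Proof.
move=> st; rewrite !tensorM; apply: eq_tensor => u.
by case: eqVneq => [->|_]; rewrite ?(negbTE st) ?mul1mx ?mulmx1.
Qed.

Lemma adj_loc t A : adjmx (loc t A) = loc t (adjmx A).
Proof.
rewrite adj_tensor; apply: eq_tensor => u; case: ifP => // _.
by rewrite adjmx_scalar conjC1.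
Qed.

(* For [s != t] this is the operator exchanging the tensor factors [s] and [t]. *)
Definition swap_op s t : 'M[C]_(tdim d T) :=
  \sum_i \sum_j loc s (delta_mx i j) *m loc t (delta_mx j i).

Lemma herm_swap s t : s != t -> herm (swap_op s t).
Proof.
move=> st; rewrite /Defs.hermitian adjmx_sum [RHS]exchange_big; apply: eq_bigr => i _.
rewrite adjmx_sum; apply: eq_bigr => j _.
by rewrite adjmxM !adj_loc !adjmx_delta -loc_mulC.
Qed.

Lemma sum_delta_diag : \sum_i delta_mx i i = 1%:M :> 'M[C]_d.
Proof.
apply/matrixP=> i j; rewrite summxE (bigD1 i) //= big1 => [|k ki].
  by rewrite !mxE eqxx addr0 eq_sym.
by rewrite mxE eq_sym (negbTE ki).
Qed.

Lemma swap_sq s t : s != t -> swap_op s t *m swap_op s t = 1%:M.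
Proof.
move=> st; rewrite {1}/swap_op mulmx_suml.
have -> : 1%:M = \sum_i \sum_j loc s (delta_mx i i) *m loc t (delta_mx j j).
  under eq_bigr => i _ do rewrite -mulmx_sumr -loc_sum sum_delta_diag loc1 mulmx1.
  by rewrite -loc_sum sum_delta_diag loc1.
apply: eq_bigr => i _; rewrite mulmx_suml; apply: eq_bigr => j _.
(* Matrix units compose at site [s] only if [k = j] and at site [t] only if [l = i], so a single
   term of the second swap survives. *)
have eqF k l : loc s (delta_mx i j) *m loc t (delta_mx j i) *m
    (loc s (delta_mx k l) *m loc t (delta_mx l k)) =
    if (k == j) && (l == i) then loc s (delta_mx i i) *m loc t (delta_mx j j) else 0.
  rewrite -mulmxA (mulmxA (loc t _)) -(loc_mulC _ _ st) -mulmxA locM mulmxA locM.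
  rewrite !mul_delta_mx_cond (eq_sym j k) (eq_sym i l).
  have [->|_] := eqVneq k j; have [->|_] := eqVneq l i; rewrite ?mulr1n ?mulr0n //=;
    by rewrite !loc0 ?mulmx0 ?mul0mx.
rewrite mulmx_sumr (bigD1 j) //= mulmx_sumr (bigD1 i) //= eqF !eqxx /= !big1 ?addr0 //.
  by move=> k kj; rewrite mulmx_sumr big1 // => l _; rewrite eqF (negbTE kj).
by move=> l li; rewrite eqF (negbTE li) andbF.
Qed.

(** * Expectations and centring in the product state *)

Section Expectation.
Variable rho : 'I_T -> 'M[C]_d.
Hypothesis rhoP : forall t, density (rho t).

Definition expect (Y : 'M[C]_(tdim d T)) : C := \tr (Y *m tensor_states rho).

Let rho_psd t : psd (rho t). Proof. by case: (rhoP t). Qed.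
Let rho_herm t : herm (rho t). Proof. by case: (rho_psd t). Qed.
Let tr_rho t : \tr (rho t) = 1. Proof. by case: (rhoP t). Qed.

Lemma expectD Y Z : expect (Y + Z) = expect Y + expect Z.
Proof. by rewrite /expect mulmxDl linearD. Qed.

Lemma expectZ x Y : expect (x *: Y) = x * expect Y.
Proof. by rewrite /expect -scalemxAl mxtraceZ. Qed.

Lemma expect_sum I (r : seq I) (P : pred I) (G : I -> 'M[C]_(tdim d T)) :
  expect (\sum_(i <- r | P i) G i) = \sum_(i <- r | P i) expect (G i).
Proof. by rewrite /expect mulmx_suml raddf_sum. Qed.

Lemma expect_tensor a : expect (tensor_states a) = \prod_t \tr (a t *m rho t).
Proof. by rewrite /expect tensorM tr_tensor. Qed.

Lemma expect1 : expect 1%:M = 1.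
Proof. by rewrite -tensor1 expect_tensor big1 // => t _; rewrite mul1mx. Qed.

Lemma expect_loc t A : expect (loc t A) = \tr (A *m rho t).
Proof.
rewrite expect_tensor (bigD1 t) //= eqxx big1 ?mulr1 // => u /negbTE->.
by rewrite mul1mx.
Qed.

(** The expectation factorises over the sites, and at [s] only [A] acts, which contributes the
    factor zero. *)
Lemma expect_loc4_eq0l s t u v A B D F : \tr (A *m rho s) = 0 ->
  s \notin [:: t; u; v] ->
  expect (loc s A *m loc t B *m (loc u D *m loc v F)) = 0.
Proof.
rewrite !inE !negb_or => h0 /and3P[/negbTE h1 /negbTE h2 /negbTE h3].
rewrite !tensorM expect_tensor; apply/eqP/prodf_eq0; exists s => //.
by rewrite eqxx h1 h2 h3 !mulmx1 h0.
Qed.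

Lemma expect_loc4_eq0r s t u v A B D F : \tr (B *m rho t) = 0 ->
  t \notin [:: s; u; v] ->
  expect (loc s A *m loc t B *m (loc u D *m loc v F)) = 0.
Proof.
rewrite !inE !negb_or => h0 /and3P[/negbTE h1 /negbTE h2 /negbTE h3].
rewrite !tensorM expect_tensor; apply/eqP/prodf_eq0; exists t => //.
by rewrite eqxx h1 h2 h3 !mulmx1 mul1mx h0.
Qed.

Lemma expect_sq_ge0 Y : herm Y -> 0 <= expect (Y *m Y).
Proof. by move=> hY; apply: tr_herm_sq_ge0 => //; apply: psd_tensor. Qed.

Definition centered t A : 'M[C]_d := A - (\tr (A *m rho t))%:M.

Lemma tr_centered t A : \tr (centered t A *m rho t) = 0.
Proof. by rewrite mulmxBl linearB /= mul_scalar_mx mxtraceZ tr_rho mulr1 subrr. Qed.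

Lemma herm_centered t A : herm A -> herm (centered t A).
Proof. by move=> hA; apply: hermB => //; apply/herm_scalar/tr_herm_mul_real. Qed.

(** The gap is the square of the mean of [A], which is real. *)
Lemma var_centered_le t A : herm A ->
  \tr (centered t A *m centered t A *m rho t) <= \tr (A *m A *m rho t).
Proof.
move=> hA; rewrite -subr_ge0; set x := \tr (A *m rho t).
have rx : x \is Num.real by apply: tr_herm_mul_real.
suff -> : \tr (A *m A *m rho t) - \tr (centered t A *m centered t A *m rho t) = x ^+ 2.
  by rewrite real_exprn_even_ge0.
rewrite /centered -/x !(mulmxBl, mulmxBr) !mul_mx_scalar !mul_scalar_mx -!scalemxAl.
rewrite !(raddfB mxtrace) /= !mxtraceZ -/x mul_scalar_mx !mxtraceZ tr_rho.
ring.
Qed.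

(* The part of the swap that is centred at both sites: [centered s A] subtracts from
   [A] its expectation in the state [rho s]. *)
Definition cswap s t : 'M[C]_(tdim d T) :=
  \sum_i \sum_j loc s (centered s (delta_mx i j)) *m loc t (centered t (delta_mx j i)).

Lemma tr_delta_mul i j A : \tr (delta_mx i j *m A) = A j i.
Proof.
rewrite /mxtrace (bigD1 i) //= big1 => [|k ki]; last first.
  by rewrite mxE big1 // => l _; rewrite mxE (negbTE ki) mul0r.
rewrite addr0 mxE (bigD1 j) //= big1 ?addr0; last first.
  by move=> l lj; rewrite mxE (negbTE lj) andbF mul0r.
by rewrite mxE !eqxx mul1r.
Qed.

(** Expand the centring bilinearly: the matrix units at one site, weighted by their partners'
    expectations at the other, resum to the state of that other site. *)
Lemma cswapE s t : cswap s t =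
  swap_op s t - (loc s (rho t) + loc t (rho s) - (\tr (rho s *m rho t))%:M).
Proof.
have e1 : loc s (rho t) = \sum_i \sum_j rho t i j *: loc s (delta_mx i j).
  rewrite {1}[rho t]matrix_sum_delta loc_sum; apply: eq_bigr => i _.
  by rewrite loc_sum; apply: eq_bigr => j _; rewrite locZ.
have e2 : loc t (rho s) = \sum_i \sum_j rho s j i *: loc t (delta_mx j i).
  rewrite {1}[rho s]matrix_sum_delta loc_sum exchange_big; apply: eq_bigr => i _.
  by rewrite loc_sum; apply: eq_bigr => j _; rewrite locZ.
have e3 : (\tr (rho s *m rho t))%:M
    = \sum_i \sum_j (rho s j i * rho t i j)%:M :> 'M_(tdim d T).
  rewrite /mxtrace raddf_sum exchange_big; apply: eq_bigr => i _.
  by rewrite mxE raddf_sum.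
rewrite e1 e2 e3 -!(big_split, sumrB) /=; apply: eq_bigr => i _.
rewrite -!(big_split, sumrB) /=; apply: eq_bigr => j _.
rewrite /centered !tr_delta_mul !locB !loc_scalar !(mulmxBl, mulmxBr).
rewrite mul_mx_scalar !mul_scalar_mx scale_scalar_mx !opprD !opprK !addrA.
by rewrite addrAC.
Qed.

Lemma swap_opC s t : s != t -> swap_op s t = swap_op t s.
Proof.
move=> st; rewrite /swap_op exchange_big; apply: eq_bigr => i _.
by apply: eq_bigr => j _; apply: loc_mulC.
Qed.

Lemma cswapC s t : s != t -> cswap s t = cswap t s.
Proof.
move=> st; rewrite !cswapE swap_opC // (addrC (loc s _)).
by rewrite (mxtrace_mulC (rho s)).
Qed.

(** One of [s], [t] lies outside the pair [u], [v]; the factor there is centred and meets no other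
    operator. *)
Lemma expect_cswapM_eq0 s t u v : s != t -> (u, v) != (s, t) -> (u, v) != (t, s) ->
  u != v -> expect (cswap s t *m cswap u v) = 0.
Proof.
rewrite !xpair_eqE => st h1 h2 uv.
rewrite mulmx_suml expect_sum big1 // => i _.
rewrite mulmx_suml expect_sum big1 // => j _.
rewrite mulmx_sumr expect_sum big1 // => k _.
rewrite mulmx_sumr expect_sum big1 // => l _.
have [suv|suv] := boolP (s \in [:: u; v]); last first.
  apply: expect_loc4_eq0l; first exact: tr_centered.
  by rewrite inE negb_or st.
apply: expect_loc4_eq0r; first exact: tr_centered.
move: suv; rewrite !inE !negb_or (eq_sym t s) st /=.
rewrite (eq_sym t u) (eq_sym t v) (eq_sym s u) (eq_sym s v).
case/orP => /eqP e; subst.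
  by rewrite st /=; move: h1; rewrite eqxx.
by rewrite st andbT; move: h2; rewrite eqxx andbT.
Qed.

Lemma expect_cswap_loc_eq0 s t u A : s != t -> u \in [:: s; t] ->
  expect (cswap s t *m loc u A) = 0.
Proof.
(* Padding with the identity at [u] gives the four-factor form; the site of the swap other than [u]
   then carries a lone centred factor. *)
move=> st us; rewrite -[loc u A]mulmx1 -(loc1 u).
rewrite mulmx_suml expect_sum big1 // => i _.
rewrite mulmx_suml expect_sum big1 // => j _.
move: us; rewrite !inE => /orP[]/eqP->.
  by apply: expect_loc4_eq0r; [exact: tr_centered | rewrite !inE eq_sym !negb_or st].
by apply: expect_loc4_eq0l; [exact: tr_centered | rewrite !inE !negb_or st].
Qed.

Lemma expect_adj Y : expect (adjmx Y) = (expect Y)^*.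
Proof.
rewrite /expect -mxtrace_adj adjmxM (proj1 (psd_tensor rho_psd)).
by rewrite mxtrace_mulC.
Qed.

(* The centred swap is orthogonal to the one-site part of the swap, so its second
   moment is at most that of the swap, which squares to the identity. *)
Lemma expect_cswap_sq_le1 s t : s != t -> expect (cswap s t *m cswap s t) <= 1.
Proof.
move=> st; set G := loc s (rho t) + loc t (rho s) - (\tr (rho s *m rho t))%:M.
have WE : cswap s t = swap_op s t - G by exact: cswapE.
have hG : herm G.
  apply: hermB; last exact/herm_scalar/tr_herm_mul_real.
  by apply: hermD; rewrite /Defs.hermitian adj_loc rho_herm.
have hW : herm (cswap s t) by rewrite WE; apply: hermB => //; apply: herm_swap.
have WG : expect (cswap s t *m G) = 0.
  rewrite /G -[(\tr _)%:M](loc_scalar t) mulmxBr mulmxDr -scaleN1r !expectD expectZ.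
  by rewrite !expect_cswap_loc_eq0 ?inE ?eqxx ?orbT // mulr0 !addr0.
have GW : expect (G *m cswap s t) = 0.
  by rewrite -[G *m _]adjmxK expect_adj adjmxM hG hW WG conjC0.
clearbody G; have := expect1; rewrite -(swap_sq st).
have -> : swap_op s t = cswap s t + G by rewrite WE subrK.
rewrite mulmxDl !mulmxDr !expectD WG GW addr0 add0r => <-.
by rewrite lerDl expect_sq_ge0.
Qed.

Local Notation offdiag := (fun p : 'I_T * 'I_T => p.1 != p.2).

Lemma sum_offdiag (V : nmodType) (F : 'I_T -> 'I_T -> V) :
  \sum_(p | offdiag p) F p.1 p.2 = \sum_s \sum_(t | t != s) F s t.
Proof.
rewrite pair_big_dep /=; apply: eq_bigl => p.
by rewrite eq_sym.
Qed.

Lemma sum_offdiag_sym (V : nmodType) (F : 'I_T -> 'I_T -> V) :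
  \sum_(p | offdiag p) F p.2 p.1 = \sum_(p | offdiag p) F p.1 p.2.
Proof.
rewrite (reindex_inj (h := fun p => (p.2, p.1))) /=; last by move=> [? ?] [? ?] [-> ->].
by apply: eq_bigl => p; rewrite eq_sym.
Qed.

(** In the expanded square an ordered pair correlates only with itself and its reversal, each
    contributing at most 1; there are at most [T ^ 2] ordered pairs. *)
Lemma sum_cswap_sq_le :
  expect ((\sum_(p | offdiag p) cswap p.1 p.2) *m (\sum_(p | offdiag p) cswap p.1 p.2))
    <= 2 * T%:R ^+ 2.
Proof.
rewrite mulmx_suml expect_sum.
apply: (@le_trans _ _ (\sum_(p : 'I_T * 'I_T | offdiag p) 2)); last first.
  rewrite big_mkcond; apply: (@le_trans _ _ (\sum_(p : 'I_T * 'I_T) 2)).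
    by apply: ler_sum => p _; case: ifP.
  by rewrite sumr_const card_prod !card_ord -[_ *+ (T * T)]mulr_natr natrM.
apply: ler_sum => -[s t] /= st; rewrite mulmx_sumr expect_sum.
rewrite (bigD1 (s, t)) //= (bigD1 (t, s)) /=; last first.
  by rewrite eq_sym st xpair_eqE eq_sym (negbTE st).
rewrite big1 => [|[u v] /= /andP[/andP[uv h1] h2]]; last exact: expect_cswapM_eq0.
rewrite addr0 -(cswapC st) -[2]/(1 + 1).
by apply: lerD; apply: expect_cswap_sq_le1.
Qed.

(** * The one-site part of the statistic *)

Definition state_sum : 'M[C]_d := \sum_t rho t.

Lemma herm_state_sum : herm state_sum.
Proof. exact: herm_sum. Qed.

(** This allows [state_sum] to be shifted by a scalar matrix before its second moment is bounded. *)
Lemma centered_subs t A x : centered t (A - x%:M) = centered t A.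
Proof.
rewrite /centered mulmxBl linearB /= mul_scalar_mx mxtraceZ tr_rho mulr1.
by rewrite raddfB /= opprB addrA subrK.
Qed.

Definition lin_part : 'M[C]_(tdim d T) := \sum_t loc t (centered t (state_sum - rho t)).

Lemma herm_lin_part : herm lin_part.
Proof.
apply: herm_sum => t _; rewrite /Defs.hermitian adj_loc.
by rewrite (herm_centered t (hermB herm_state_sum (rho_herm t))).
Qed.

Lemma lin_part_sq : expect (lin_part *m lin_part) =
  \sum_t \tr (centered t (state_sum - rho t) *m centered t (state_sum - rho t) *m rho t).
Proof.
rewrite mulmx_suml expect_sum; apply: eq_bigr => s _.
rewrite mulmx_sumr expect_sum (bigD1 s) //= big1 ?addr0 ?locM ?expect_loc // => t ts.
rewrite -[loc s _]mulmx1 -[loc t _]mulmx1 -{1 2}(loc1 t).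
by apply: expect_loc4_eq0l; [exact: tr_centered | rewrite !inE eq_sym !negb_or ts].
Qed.

(** At each site the variance is at most the second moment of [Q - rho t], which [tr_sqD_le] splits.
    As [rho t] is at most the identity, the [Q] term is at most [\tr (Q *m Q)] and the other at most
    the purity of [rho t]. *)
Lemma lin_part_sq_le x (Q := state_sum - x%:M) : x \is Num.real ->
  expect (lin_part *m lin_part) <= 2 * T%:R * \tr (Q *m Q) + 2 * T%:R.
Proof.
move=> rx; have hQ : herm Q by apply: hermB; [exact: herm_state_sum | exact: herm_scalar].
rewrite lin_part_sq.
apply: (@le_trans _ _ (\sum_(t < T) (2 * \tr (Q *m Q) + 2))); last first.
  by rewrite sumr_const card_ord -[_ *+ T]mulr_natr mulrDl mulrAC.
apply: ler_sum => t _; rewrite -(centered_subs t _ x) addrAC -/Q.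
apply: le_trans (var_centered_le _ _) _; first exact: hermB.
have hN : herm (- rho t) by rewrite -sub0r -(raddf0 scalar_mx); apply/hermB/rho_herm/herm_scalar.
apply: le_trans (tr_sqD_le hQ hN (rho_psd t)) _.
apply: lerD; first by rewrite ler_pM2l ?ltr0n //; apply/tr_psd_density_le/rhoP/herm_sq_psd.
rewrite mulmxN !mulNmx opprK -[leRHS]mulr1 ler_pM2l ?ltr0n //.
apply: le_trans (tr_density_sq_le1 (rhoP t)).
exact/tr_psd_density_le/rhoP/herm_sq_psd.
Qed.

(** * Mean and variance of the statistic *)

Definition swap_total : 'M[C]_(tdim d T) := \sum_(p | offdiag p) swap_op p.1 p.2.

Lemma herm_swap_total : herm swap_total.
Proof. by apply: herm_sum => -[s t]; apply: herm_swap. Qed.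

Definition swap_mean : C := \sum_(p | offdiag p) \tr (rho p.1 *m rho p.2).

Lemma swap_mean_real : swap_mean \is Num.real.
Proof. by apply: rpred_sum => p _; apply: tr_herm_mul_real. Qed.

Lemma sum_others s : \sum_(t | t != s) rho t = state_sum - rho s.
Proof. by rewrite /state_sum [X in X - _](bigD1 s) //= [RHS]addrC addKr. Qed.

Lemma swap_meanE : swap_mean = \tr (state_sum *m state_sum) - \sum_t \tr (rho t *m rho t).
Proof.
rewrite /swap_mean (sum_offdiag (fun s t => \tr (rho s *m rho t))).
rewrite {1}/state_sum mulmx_suml raddf_sum -sumrB; apply: eq_bigr => s _.
by rewrite -raddf_sum -mulmx_sumr sum_others mulmxBr raddfB.
Qed.

Lemma swap_total_decomp : swap_total - swap_mean%:M =
  \sum_(p | offdiag p) cswap p.1 p.2 + 2 *: lin_part.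
Proof.
(* For fixed [s] the other states add up to [state_sum - rho s]; centring it at [s] splits off its
   mean, and these means total [swap_mean]. *)
have e1 : \sum_(p | offdiag p) loc p.1 (rho p.2) = lin_part + swap_mean%:M.
  rewrite (sum_offdiag (fun s t => loc s (rho t))) /swap_mean.
  rewrite -(sum_offdiag_sym (fun s t => \tr (rho s *m rho t))) /=.
  rewrite (sum_offdiag (fun s t => \tr (rho t *m rho s))) raddf_sum -big_split /=.
  apply: eq_bigr => s _; rewrite -loc_sum sum_others /centered [loc s (_ - _%:M)]locB loc_scalar.
  by rewrite -raddf_sum -mulmx_suml sum_others subrK.
have e2 : \sum_(p | offdiag p) loc p.2 (rho p.1) = lin_part + swap_mean%:M.
  by rewrite (sum_offdiag_sym (fun s t => loc s (rho t))).
under [in RHS]eq_bigr => p _ do rewrite cswapE.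
rewrite sumrB sumrB big_split /= e1 e2 -raddf_sum -/swap_mean -/swap_total.
rewrite scaler_nat mulr2n /=; move: swap_total lin_part _%:M => x y z.
(* Each of the two one-site sums brings a copy of the mean, and the constants of [cswapE] remove
   one. *)
have -> : y + z + (y + z) - z = z + (y + y) by rewrite addrA addrK addrAC addrC.
by rewrite opprD (addrA x) subrK.
Qed.

Lemma swap_total_var_le x (Q := state_sum - x%:M) : x \is Num.real ->
  expect ((swap_total - swap_mean%:M) *m (swap_total - swap_mean%:M))
    <= 20 * T%:R ^+ 2 + 16 * T%:R * \tr (Q *m Q).
Proof.
move=> rx.
have hL : herm (2 *: lin_part) by apply: hermZ; [exact: realn | exact: herm_lin_part].
have hU : herm (\sum_(p | offdiag p) cswap p.1 p.2).
  rewrite -[X in herm X](addrK (2 *: lin_part)) -swap_total_decomp.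
  apply: hermB => //; apply: hermB; [exact: herm_swap_total|].
  exact/herm_scalar/swap_mean_real.
rewrite swap_total_decomp.
apply: le_trans (tr_sqD_le hU hL (psd_tensor rho_psd)) _.
rewrite -/(expect _) -/(expect ((2 *: _) *m _)) -scalemxAl -scalemxAr !expectZ.
(* Twice the bound for the centred swaps plus twice that for [2 *: lin_part], whose square carries a
   factor 4. The leftover [16 T] is absorbed into [16 T ^ 2] because [T] is a natural number. *)
apply: (@le_trans _ _ (2 * (2 * T%:R ^+ 2)
    + 2 * (2 * (2 * (2 * T%:R * \tr (Q *m Q) + 2 * T%:R))))).
  apply: lerD; first by rewrite ler_pM2l ?ltr0n // sum_cswap_sq_le.
  by rewrite !ler_pM2l ?ltr0n // lin_part_sq_le.
rewrite -subr_ge0.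
have -> : 20 * T%:R ^+ 2 + 16 * T%:R * \tr (Q *m Q) - (2 * (2 * T%:R ^+ 2)
    + 2 * (2 * (2 * (2 * T%:R * \tr (Q *m Q) + 2 * T%:R)))) = 16 * (T%:R ^+ 2 - T%:R) :> C.
  by ring.
by rewrite mulr_ge0 ?ler0n // subr_ge0 -natrX ler_nat; case: (T) => // k; rewrite expnS leq_pmulr.
Qed.

End Expectation.
End Tensor.

(** * Mean of the statistic and the two hypotheses *)

Section Deviation.
Variables (C : numClosedFieldType) (d T : nat) (rho : 'I_T -> 'M[C]_d).
Hypotheses (rhoP : forall t, density (rho t)) (d_gt0 : (0 < d)%N) (T_gt0 : (0 < T)%N).

Let x : C := T%:R / d%:R.

(** For density matrices this is the squared Hilbert-Schmidt norm of [T] times the difference of the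
    average and the maximally mixed state. *)
Definition deviation : C :=
  \tr ((state_sum rho - (T%:R / d%:R)%:M) *m (state_sum rho - (T%:R / d%:R)%:M)).

Let d_neq0 : d%:R != 0 :> C. Proof. by rewrite pnatr_eq0 -lt0n. Qed.
Let T_neq0 : T%:R != 0 :> C. Proof. by rewrite pnatr_eq0 -lt0n. Qed.

Lemma state_sum_sub_scalar : state_sum rho - x%:M = T%:R *: (avg_state rho - maxmixed C d).
Proof. by rewrite /avg_state /maxmixed scalerBr !scalerA mulfV // scale1r scalemx1. Qed.

Lemma herm_avg_sub : Defs.hermitian (avg_state rho - maxmixed C d).
Proof.
apply: hermB; last by apply: hermZ; rewrite ?rpredV ?realn //; apply: herm_scalar; exact: real1.
by apply: hermZ; rewrite ?rpredV ?realn //; apply: herm_state_sum.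
Qed.

Lemma deviationE : deviation = T%:R ^+ 2 *
  \tr ((avg_state rho - maxmixed C d) *m (avg_state rho - maxmixed C d)).
Proof.
by rewrite /deviation -/x state_sum_sub_scalar -scalemxAl -scalemxAr scalerA mxtraceZ expr2.
Qed.

Lemma tr_state_sum_sq : \tr (state_sum rho *m state_sum rho) = deviation + T%:R ^+ 2 / d%:R.
Proof.
have trS : \tr (state_sum rho) = T%:R.
  rewrite raddf_sum (eq_bigr (fun=> 1)) ?sumr_const ?card_ord // => t _.
  by case: (rhoP t).
rewrite /deviation mulmxBl !mulmxBr mul_mx_scalar !mul_scalar_mx scale_scalar_mx.
rewrite !(raddfB mxtrace) /= !mxtraceZ mxtrace_scalar trS -mulr_natl.
by field.
Qed.

(** The mean falls short of the trace of the squared [state_sum] by the sum of the purities, each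
    between 0 and 1. *)
Lemma swap_mean_bounds :
  deviation + T%:R ^+ 2 / d%:R - T%:R <= swap_mean rho <= deviation + T%:R ^+ 2 / d%:R.
Proof.
rewrite swap_meanE tr_state_sum_sq lerD2l lerN2 gerBl; apply/andP; split.
  rewrite -[leRHS](_ : \sum_(t < T) 1 = T%:R); last by rewrite sumr_const card_ord.
  by apply: ler_sum => t _; apply: tr_density_sq_le1.
by apply: sumr_ge0 => t _; apply: tr_psdM_ge0; case: (rhoP t).
Qed.

(** The trace norm of [D] exceeds [2 * e], so [trace_norm_sq_le] bounds its Hilbert-Schmidt norm
    from below; scale by [T ^ 2]. *)
Lemma trace_dist_deviation (e : C) : 0 <= e ->
  e < trace_dist (avg_state rho) (maxmixed C d) ->
  4 * e ^+ 2 * T%:R ^+ 2 <= d%:R * deviation.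
Proof.
move=> e0; rewrite /trace_dist; set D := avg_state rho - _ => he.
have [n0 hn] := trace_norm_sq_le D.
have h2 : 2 * e <= trace_norm D by rewrite -ler_pdivlMl ?ltr0n // ltW.
have : (2 * e) ^+ 2 <= d%:R * \tr (D *m D).
  rewrite -[X in X *m D]herm_avg_sub; apply: le_trans hn.
  by rewrite lerXn2r ?nnegrE // mulr_ge0 ?ler0n.
move=> h; rewrite deviationE (mulrCA d%:R) [leLHS]mulrC ler_pM2l ?exprn_gt0 ?ltr0n //.
by apply: le_trans h; rewrite exprMn -natrX.
Qed.

End Deviation.

Lemma deviation_real (C : numClosedFieldType) (d T : nat) (rho : 'I_T -> 'M[C]_d) :
  (forall t, density (rho t)) -> deviation rho \is Num.real.
Proof.
move=> rhoP; suff h : Defs.hermitian (state_sum rho - (T%:R / d%:R)%:M).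
  exact: tr_herm_mul_real.
by apply: hermB; [exact: herm_state_sum | apply: herm_scalar; rewrite rpredM ?rpredV ?realn].
Qed.

(** * Numerical tail estimates *)

Lemma null_tail_le (R : realFieldType) (t b c q : R) : 0 < t -> 0 <= q -> c <= b ->
  (b + 100 * t - c) ^+ 2 * q <= 20 * t ^+ 2 -> q <= 1 / 100.
Proof.
move=> t0 q0 cb h; have t20 : 0 < t ^+ 2 by rewrite exprn_gt0.
(* The threshold is at least [100 * t] above the mean [c], which leaves [q] at most
   [20 / 100 ^ 2]. *)
have : (100 * t) ^+ 2 * q <= 20 * t ^+ 2.
  by apply: le_trans h; rewrite ler_wpM2r // lerXn2r ?nnegrE; lra.
rewrite exprMn mulrAC => h'.
have : 100 ^+ 2 * q <= 20 by rewrite -(ler_pM2r t20).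
by lra.
Qed.

(** The mean exceeds the threshold by at least [m - 101 * t], hence by [m / 2]. Then [m ^ 2 * p] is
    at most [4 * 36 * t * m], and [144 / 16000] is below [1 / 100]. *)
Lemma far_tail_le (R : realFieldType) (t b c m p : R) : 0 < t -> 0 <= p ->
  16000 * t <= m -> m + b - t <= c ->
  (c - (b + 100 * t)) ^+ 2 * p <= 20 * t ^+ 2 + 16 * t * m -> p <= 1 / 100.
Proof.
move=> t0 p0 tm mc h; have m0 : 0 < m by lra.
have m20 : 0 < m ^+ 2 by rewrite exprn_gt0.
have h1 : (m / 2) ^+ 2 * p <= 20 * t ^+ 2 + 16 * t * m.
  by apply: le_trans h; rewrite ler_wpM2r // lerXn2r ?nnegrE; lra.
have h2 : 16000 * (t * m) <= m ^+ 2 by rewrite mulrA expr2 ler_pM2r.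
have h3 : t ^+ 2 <= t * m by rewrite expr2 ler_pM2l //; lra.
have h4 : m ^+ 2 * p <= m ^+ 2 * (1 / 100).
  have -> : m ^+ 2 * p = 4 * ((m / 2) ^+ 2 * p) by field.
  by lra.
by rewrite -(ler_pM2l m20).
Qed.

Local Open Scope complex_scope.

Theorem theorem2p3 (R : realType) :
  exists K : R, 0 < K /\
  forall (d : nat) (eps : R) (T : nat),
    (1 <= d)%N -> 0 < eps -> K * (d%:R / eps ^+ 2) <= T%:R ->
    exists M : 'M[R[i]]_(tdim d T),
      accept_op M /\
      forall rho : 'I_T -> 'M[R[i]]_d,
        (forall t, density (rho t)) ->
        (avg_state rho = maxmixed R[i] d ->
           (99%:R / 100%:R)%:C <= accept_prob M (tensor_states rho)) /\
        (eps%:C < trace_dist (avg_state rho) (maxmixed R[i] d) ->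
           accept_prob M (tensor_states rho) <= (1 / 100%:R)%:C).
Proof.
(* With this constant the deviation in the far case is at least [4 * 4000 * T], the hypothesis of
   [far_tail_le]. *)
exists 4000%:R; split; first by rewrite ltr0n.
move=> d eps T d_gt0 eps_gt0 hT.
have d_gt0R : 0 < d%:R :> R by rewrite ltr0n.
have T_gt0R : 0 < T%:R :> R.
  by apply: lt_le_trans hT; rewrite mulr_gt0 ?ltr0n // divr_gt0 // exprn_gt0.
have T_gt0 : (0 < T)%N by rewrite -(ltr0n R).
set b : R := T%:R ^+ 2 / d%:R.
pose theta : R := b + 100%:R * T%:R.
pose M := spectral_le (swap_total R[i] d T) theta%:C.
have MP : accept_op M by exact: spectral_le_accept.
exists M; split=> // rho rhoP.
have psdW : psd (tensor_states rho) by apply: psd_tensor => t; case: (rhoP t).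
have hX := @herm_swap_total R[i] d T.
have rc := swap_mean_real rhoP.
have rx : T%:R / d%:R \is @Num.real R[i] by rewrite rpredM ?rpredV ?realn.
have var_le := swap_total_var_le rhoP rx; rewrite -/(deviation rho) in var_le.
have cheb_u := chebyshev_upper hX psdW rc (theta := theta%:C).
have cheb_l := chebyshev_lower hX psdW rc (theta := theta%:C).
rewrite -/M in cheb_u cheb_l.
have far := trace_dist_deviation rhoP T_gt0 (e := eps%:C).
have devE := deviationE rho T_gt0.
have acc : accept_prob M (tensor_states rho)
    = 1 - \tr ((1%:M - M) *m tensor_states rho).
  by rewrite mulmxBl raddfB /= -/(expect rho 1%:M) expect1 // subKr.
have /andP[lo up] := swap_mean_bounds rhoP d_gt0.
have p0 : 0 <= accept_prob M (tensor_states rho) := tr_psdM_ge0 (proj1 MP) psdW.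
have q0 := tr_psdM_ge0 (proj2 MP) psdW.
have natC n : n%:R = (n%:R)%:C :> R[i] by rewrite rmorph_nat.
have bC : T%:R ^+ 2 / d%:R = b%:C :> R[i].
  by rewrite !natC -rmorphXn -fmorphV -rmorphM.
(* Mean and deviation are real, so each is replaced by the embedding of its real part, [c] and [m];
   the bounds then descend to [R]. *)
move: (RRe_real rc) (RRe_real (deviation_real rhoP)) => cE mE.
move: (complex.Re _) cE (complex.Re _) mE => c cE m mE.
have realC := (rmorphD (real_complex R), rmorphM (real_complex R),
  rmorphB (real_complex R), rmorphXn (real_complex R)).
rewrite bC -{}mE -{}cE !natC in var_le lo up far devE cheb_u cheb_l.
rewrite -!realC !lecR in var_le lo up far cheb_u cheb_l.
split=> [h0 | hfar].
  have m0 : m = 0.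
    by apply: complexI; rewrite devE h0 subrr mul0mx raddf0 mulr0.
  have := RRe_real (ger0_real q0).
  move: (complex.Re _) => q qE; rewrite acc -qE in q0 cheb_u *.
  have -> : 1 - q%:C = (1 - q)%:C by rewrite rmorphB rmorph1.
  rewrite !lecR in q0 *.
  suff : q <= 1 / 100 by lra.
  have cb : c <= b by rewrite m0 add0r in up.
  apply: (null_tail_le T_gt0R q0 cb).
  have cth : c <= theta by rewrite /theta; lra.
  by have := le_trans (cheb_u cth) var_le; rewrite -!realC lecR m0 mulr0 addr0; apply.
have := RRe_real (ger0_real p0).
move: (complex.Re _) => p pE; rewrite -/(accept_prob M _) -pE in p0 cheb_l *.
rewrite !lecR in p0 *.
(* [hT] gives [4000 * d <= T * eps ^ 2], to be combined with the lower bound [far] on [d * m]. *)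
have tm : 16000 * T%:R <= m.
  have := far (ltW eps_gt0) hfar.
  have e20 : 0 < eps ^+ 2 by rewrite exprn_gt0.
  move: hT; rewrite mulrA ler_pdivrMr // => hT1 hT2.
  rewrite -(ler_pM2l d_gt0R); apply: le_trans hT2.
  have -> : d%:R * (16000 * T%:R) = 4 * T%:R * (4000 * d%:R) :> R by ring.
  have -> : 4 * eps ^+ 2 * T%:R ^+ 2 = 4 * T%:R * (T%:R * eps ^+ 2) :> R by ring.
  by rewrite ler_pM2l // mulr_gt0.
apply: (far_tail_le T_gt0R p0 tm lo).
have thc : theta <= c by rewrite /theta; lra.
by have := le_trans (cheb_l thc) var_le; rewrite -!realC lecR.
Qed.
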